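(* Let $d\ge2$ and $\mu>-1$. The spectral operator $\mathcal{D}_\mu$ on $\mathbb{B}^d$ satisfies $$\mathcal{D}_\mu=\frac{1}{W_\mu(x)}\left[\frac{1}{\|x\|^d}\langle x,\nabla\rangle\left(\|x\|^{d-2}(1-\|x\|^2)W_\mu(x)\langle x,\nabla\rangle\right)\right]+\frac{1}{\|x\|^2}\mathcal{D}_{\mathbb{S}},$$ as an identity of differential operators; that is, for every $C^2$ function $f$ and every $x$ with $0<\|x\|<1$, $$\mathcal{D}_\mu f(x)=\frac{1}{W_\mu(x)\,\|x\|^d}\,\langle x,\nabla\rangle\Big(\|x\|^{d-2}(1-\|x\|^2)W_\mu(x)\,\langle x,\nabla\rangle f(x)\Big)+\frac{1}{\|x\|^2}\,\mathcal{D}_{\mathbb{S}}f(x).$$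
   Context: $\mathbb{B}^d=\{x\in\mathbb{R}^d:\|x\|\le1\}$, $W_\mu(x)=(1-\|x\|^2)^\mu$ with $\mu>-1$, $\langle x,\nabla\rangle=\sum_{i=1}^d x_i\partial_i$. The spectral operator is $$\mathcal{D}_\mu=\sum_{i=1}^d(1-x_i^2)\partial_i^2-2\sum_{1\le i<j\le d}x_ix_j\partial_i\partial_j-(d+2\mu+1)\sum_{i=1}^d x_i\partial_i.$$ The spherical part is $\mathcal{D}_{\mathbb{S}}=\sum_{1\le i<j\le d}D_{i,j}^2$, where $D_{i,j}=x_i\partial_j-x_j\partial_i$. *)

(* Defs.v *)
From HB Require Import structures.
From mathcomp Require Import all_boot all_order all_algebra.
From mathcomp Require Import all_classical all_reals all_analysis.
Import Order.TTheory GRing.Theory Num.Theory.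
Import numFieldNormedType.Exports.

Set Implicit Arguments.
Unset Strict Implicit.
Unset Printing Implicit Defensive.

Local Open Scope classical_set_scope.
Local Open Scope ring_scope.

(* The canonical norm of ['rV[R]_d] in the library is the sup norm, hence a
   separate Euclidean norm. The two norms induce the same topology, so the
   derivatives and the continuity below do not depend on this choice. *)
Definition enorm (R : realType) (d : nat) (x : 'rV[R]_d) : R :=
  Num.sqrt (\sum_(i < d) x 0 i ^+ 2).

Definition unit_ball (R : realType) (d : nat) : set 'rV[R]_d :=
  [set x | enorm x < 1].

Definition weight (R : realType) (d : nat) (mu : R) (x : 'rV[R]_d) : R :=
  (1 - enorm x ^+ 2) `^ mu.

Definition partial (R : realType) (d : nat) (i : 'I_d) (f : 'rV[R]_d -> R) :
    'rV[R]_d -> R :=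
  fun x => 'D_(delta_mx 0 i) f x.

(* [C^k] on [U], meant for an open [U]. *)
Fixpoint Ck_on (R : realType) (d : nat) (k : nat) (U : set 'rV[R]_d)
    (f : 'rV[R]_d -> R) : Prop :=
  (forall x, U x -> {for x, continuous f}) /\
  match k with
  | 0%N => True
  | k'.+1 => forall i : 'I_d,
      (forall x, U x -> derivable f x (delta_mx 0 i)) /\
      Ck_on k' U (partial i f)
  end.

(* <x, nabla> *)
Definition euler (R : realType) (d : nat) (f : 'rV[R]_d -> R) :
    'rV[R]_d -> R :=
  fun x => \sum_(i < d) x 0 i * partial i f x.

Definition spectral_op (R : realType) (d : nat) (mu : R)
    (f : 'rV[R]_d -> R) : 'rV[R]_d -> R :=
  fun x =>
    \sum_(i < d) (1 - x 0 i ^+ 2) * partial i (partial i f) x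
    - 2 * (\sum_(i < d) \sum_(j < d | (i < j)%N)
             x 0 i * x 0 j * partial i (partial j f) x)
    - (d%:R + 2 * mu + 1) * (\sum_(i < d) x 0 i * partial i f x).

Definition angular (R : realType) (d : nat) (i j : 'I_d)
    (f : 'rV[R]_d -> R) : 'rV[R]_d -> R :=
  fun x => x 0 i * partial j f x - x 0 j * partial i f x.

Definition spherical_op (R : realType) (d : nat) (f : 'rV[R]_d -> R) :
    'rV[R]_d -> R :=
  fun x => \sum_(i < d) \sum_(j < d | (i < j)%N)
             angular i j (angular i j f) x.

(* Main.v *)
Require Import Defs.
From HB Require Import structures.
From mathcomp Require Import all_boot all_order all_algebra.
From mathcomp Require Import all_classical all_reals all_analysis.
From mathcomp Require Import ring.
Import Order.TTheory GRing.Theory Num.Theory.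
Import numFieldNormedType.Exports.

Local Open Scope classical_set_scope.
Local Open Scope ring_scope.

(** The identity compares two ways of writing the same second-order operator.
    At [x] put [r = enorm x], [E = euler f x], [L] for the Laplacian
    [\sum_i partial i (partial i f) x], and [Q] for the Hessian form
    [\sum_i \sum_j x_i x_j partial i (partial j f) x].  Every term of the
    identity is a combination of [L], [Q] and [E]:
    - the spectral operator is [L - Q - (d + 2 mu + 1) E] ([spectral_opE]);
    - the spherical operator is [r^2 L - Q - (d - 1) E] ([spherical_opE]);
    - applying the Euler operator twice gives [E + Q] ([euler_euler]), and on
      a function of [r] the Euler operator is [r d/dr], so that the radial term
      only needs the derivative of [r^(d-2) (1 - r^2)^(mu+1)]
      ([is_derive_radial_weight], [euler_radial_mul]).
    What is left is an equality of rational expressions in [r].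

    The operators do not display the mixed derivatives symmetrically: the
    spectral operator contains [partial i (partial j f)] for [i < j] only, the
    squares of the angular derivatives contain both orders, and [Q] contains
    each of them once.  The symmetry of second derivatives is therefore
    essential; it is [derive_symmetric], obtained by applying the mean value
    theorem twice to a second difference. *)

(** * Symmetry of second directional derivatives *)

Lemma is_derive_along_line (R : realType) (V : normedModType R) (g : V -> R)
    (a w : V) (s l : R) :
  is_derive (a + s *: w) w g l <->
  is_derive s 1 (fun t : R => g (a + t *: w)) l.
Proof.
have E : (fun h : R => h^-1 *: ((g \o shift (a + s *: w)) (h *: w)
            - g (a + s *: w))) =
         (fun h : R => h^-1 *: (((fun t : R => g (a + t *: w)) \o shift s)
            (h *: (1 : R)) - g (a + s *: w))).
  apply/funext => h /=; congr (_ *: (g _ - _)).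
  by rewrite [h *: (1 : R)]mulr1 scalerDl addrCA.
by split=> -[d1 d2]; split; move: d1 d2; rewrite /derivable /derive E.
Qed.

Lemma MVT_along_line {R : realType} {V : normedModType R} {g : V -> R}
    {a w : V} {h : R} :
  0 < h ->
  (forall s, 0 <= s <= h -> derivable g (a + s *: w) w) ->
  exists2 s, 0 < s < h & g (a + h *: w) - g a = h * 'D_w g (a + s *: w).
Proof.
move=> h0 dg.
have dl s : s \in `[0, h] ->
    is_derive s 1 (fun t : R => g (a + t *: w)) ('D_w g (a + s *: w)).
  rewrite in_itv/= => sh.
  exact: (is_derive_along_line R V g a w s _).1 (derivableP (dg s sh)).
have cg : {within `[0, h], continuous (fun t : R => g (a + t *: w))}.
  by apply: derivable_within_continuous => s /dl [].
have dlo s : s \in `]0, h[ ->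
    is_derive s 1 (fun t : R => g (a + t *: w)) ('D_w g (a + s *: w)).
  by move=> sh; apply: dl; apply: subset_itv_oo_cc.
have [s] := @MVT R (fun t => g (a + t *: w)) (fun t => 'D_w g (a + t *: w))
  0 h h0 dlo cg.
rewrite in_itv/= => sh.
rewrite scale0r addr0 subr0 mulrC => E.
by exists s.
Qed.

(** Apply the mean value theorem in the direction [u] to
    [y |-> f (y + h v) - f y], then in the direction [v] to [D_u f].  The
    second difference is symmetric in [u] and [v], which is what makes both
    orders of differentiation comparable. *)
Lemma second_difference_MVT {R : realType} {V : normedModType R} {f : V -> R}
    {x u v : V} {h : R} :
  0 < h ->
  (forall s t, 0 <= s <= h -> 0 <= t <= h ->
     derivable f (x + s *: u + t *: v) u /\
     derivable ('D_u f) (x + s *: u + t *: v) v) ->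
  exists s t, [/\ 0 < s < h, 0 < t < h &
    f (x + h *: u + h *: v) - f (x + h *: u) - f (x + h *: v) + f x =
    h ^+ 2 * 'D_v ('D_u f) (x + s *: u + t *: v)].
Proof.
move=> h0 df.
have hh : 0 <= h <= h by rewrite ltW//=.
have h00 : 0 <= (0 : R) <= h by rewrite lexx ltW.
pose g y := f (y + h *: v) - f y.
have dg s : 0 <= s <= h -> is_derive (x + s *: u) u g
    ('D_u f (x + s *: u + h *: v) - 'D_u f (x + s *: u)).
  move=> sh.
  have [d1 _] := df s h sh hh.
  have [+ _] := df s 0 sh h00; rewrite scale0r addr0 => d2.
  have d3 : is_derive (x + s *: u) u (fun y => f (y + h *: v))
      ('D_u f (x + s *: u + h *: v)).
    have E : (fun k : R => k^-1 *: (((fun y => f (y + h *: v)) \o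
          shift (x + s *: u)) (k *: u) - f (x + s *: u + h *: v))) =
        (fun k : R => k^-1 *: ((f \o shift (x + s *: u + h *: v)) (k *: u)
          - f (x + s *: u + h *: v))).
      by apply/funext => k /=; rewrite !addrA.
    by split; [move: d1; rewrite /derivable -E|rewrite /derive -E].
  exact: (is_deriveB d3 (derivableP d2)).
have [s sh] : exists2 s, 0 < s < h &
    g (x + h *: u) - g x = h * 'D_u g (x + s *: u).
  by apply: (MVT_along_line h0) => s /dg [].
have s1 : 0 <= s <= h by case/andP: sh => /ltW -> /ltW ->.
have [_ ->] := dg s s1.
have [t th ->] := MVT_along_line (g := 'D_u f) h0
  (fun t th => (df s t s1 th).2).
rewrite mulrA -expr2 => E; exists s, t; split; [exact: sh|exact: th|].
by rewrite -E /g opprD opprK addrA.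
Qed.

(** The second difference with step [h] equals [h^2] times a value of
    [D_v D_u f] and also [h^2] times a value of [D_u D_v f], at two points that
    tend to [x] with [h]; continuity at [x] concludes. *)
Lemma derive_symmetric {R : realType} {V : normedModType R} {f : V -> R}
    {x u v : V} :
  (\forall y \near x, derivable f y u /\ derivable f y v) ->
  (\forall y \near x, derivable ('D_u f) y v /\ derivable ('D_v f) y u) ->
  {for x, continuous ('D_v ('D_u f))} ->
  {for x, continuous ('D_u ('D_v f))} ->
  'D_v ('D_u f) x = 'D_u ('D_v f) x.
Proof.
move=> d1 d2 c1 c2.
apply/eqP; rewrite -subr_eq0 -normr_le0; apply/ler_addgt0Pr => e e0.
rewrite add0r.
have e20 : 0 < e / 2 by rewrite divr_gt0.
have n1 : \forall y \near x, `|'D_v ('D_u f) x - 'D_v ('D_u f) y| < e / 2.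
  by move/cvgrPdist_lt: c1 => /(_ _ e20).
have n2 : \forall y \near x, `|'D_u ('D_v f) x - 'D_u ('D_v f) y| < e / 2.
  by move/cvgrPdist_lt: c2 => /(_ _ e20).
have /nbhs_ballP[r /= r0 B] : nbhs x [set y |
    ((derivable f y u /\ derivable f y v) /\
     (derivable ('D_u f) y v /\ derivable ('D_v f) y u)) /\
    (`|'D_v ('D_u f) x - 'D_v ('D_u f) y| < e / 2 /\
     `|'D_u ('D_v f) x - 'D_u ('D_v f) y| < e / 2)].
  exact: (filterI (filterI d1 d2) (filterI n1 n2)).
(* The summand 1 keeps [M] positive when [u] and [v] both vanish. *)
pose M := `|u| + `|v| + 1.
have M0 : 0 < M by rewrite ltr_wpDl// addr_ge0.
pose h := r / 2 / M.
have h0 : 0 < h by rewrite !divr_gt0.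
have close s t : 0 <= s <= h -> 0 <= t <= h -> ball x r (x + s *: u + t *: v).
  move=> /andP[s0 sh] /andP[t0 th].
  rewrite -ball_normE /ball_/= -addrA opprD addNKr normrN.
  rewrite (le_lt_trans (ler_normD _ _))// !normrZ !ger0_norm//.
  apply: (@le_lt_trans _ _ (h * M)).
    by rewrite /M !mulrDr mulr1 ler_wpDr ?(ltW h0)// lerD ?ler_wpM2r.
  by rewrite /h divfK ?gt_eqF// ltr_pdivrMr// ltr_pMr// ltr1n.
have duv s t : 0 <= s <= h -> 0 <= t <= h ->
    derivable f (x + s *: u + t *: v) u /\
    derivable ('D_u f) (x + s *: u + t *: v) v.
  move=> sh th; have [[d1' d2'] _] := B _ (close s t sh th).
  exact: (conj d1'.1 d2'.1).
have dvu s t : 0 <= s <= h -> 0 <= t <= h ->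
    derivable f (x + s *: v + t *: u) v /\
    derivable ('D_v f) (x + s *: v + t *: u) u.
  move=> sh th; rewrite addrAC; have [[d1' d2'] _] := B _ (close t s th sh).
  exact: (conj d1'.2 d2'.2).
have [s [t [sh th E1]]] := second_difference_MVT h0 duv.
have [t' [s' [th' sh' E2]]] := second_difference_MVT h0 dvu.
have W a : 0 < a < h -> 0 <= a <= h by case/andP => /ltW -> /ltW ->.
have [_ [b1 _]] := B _ (close s t (W _ sh) (W _ th)).
have [_ [_ b2]] := B _ (close s' t' (W _ sh') (W _ th')).
have EE : 'D_v ('D_u f) (x + s *: u + t *: v) =
    'D_u ('D_v f) (x + s' *: u + t' *: v).
  have h2 : h ^+ 2 != 0 by rewrite expf_neq0// gt_eqF.
  rewrite [x + s' *: u + _]addrAC; move: E1 E2.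
  rewrite [x + h *: v + _]addrAC.
  rewrite [_ - f (x + h *: v) - f (x + h *: u)]addrAC => -> E2.
  exact: (mulfI h2).
apply: (le_trans (ler_distD ('D_v ('D_u f) (x + s *: u + t *: v)) _ _)).
rewrite [e in leRHS]splitr; apply: lerD; first exact: (ltW b1).
by rewrite EE distrC; exact: (ltW b2).
Qed.

(** * Differentiation rules for functions given pointwise *)

Lemma is_derive_sum_fun {R : realType} {V : normedModType R} {n : nat}
    {h : 'I_n -> V -> R} {dh : 'I_n -> R} {x v : V} :
  (forall j, is_derive x v (h j) (dh j)) ->
  is_derive x v (fun y => \sum_(j < n) h j y) (\sum_(j < n) dh j).
Proof.
move=> D; have -> : (fun y => \sum_(j < n) h j y) = \sum_(j < n) h j.
  by apply/funext => y; rewrite fct_sumE.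
exact: is_derive_sum.
Qed.

Lemma is_derive_mul {R : realType} {V : normedModType R} {g h : V -> R}
    {x v : V} {dg dh : R} :
  is_derive x v g dg -> is_derive x v h dh ->
  is_derive x v (fun y => g y * h y) (dg * h x + g x * dh).
Proof.
move=> Dg Dh; apply: (is_derive_eq (is_deriveM Dg Dh)).
by rewrite addrC [dg * _]mulrC.
Qed.

(** Restricting [g] to the line through [x] directed by [v] turns this into the
    one-variable chain rule. *)
Lemma is_derive_comp {R : realType} {V : normedModType R} {g : V -> R}
    {phi : R -> R} {x v : V} {l m : R} :
  is_derive (g x) 1 phi l -> is_derive x v g m ->
  is_derive x v (fun y => phi (g y)) (l * m).
Proof.
move=> Dphi Dg; have x0 : x = x + (0 : R) *: v by rewrite scale0r addr0.
rewrite x0 in Dphi Dg *; apply/is_derive_along_line.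
exact: (is_derive1_comp Dphi ((is_derive_along_line _ _ _ _ _ _ _).1 Dg)).
Qed.

Lemma is_derive_exprn {R : realType} (n : nat) (t : R) :
  is_derive t 1 (fun s : R => s ^+ n) (n%:R * t ^+ n.-1).
Proof.
split; first exact: exprn_derivable.
by rewrite exp_derive /GRing.scale/= mulr1.
Qed.

Lemma is_derive_coord {R : realType} {d : nat} (x : 'rV[R]_d) (i j : 'I_d) :
  is_derive x (delta_mx 0 i) (fun y : 'rV[R]_d => y 0 j) (i == j)%:R.
Proof.
have C : (fun h : R => h^-1 *: (((fun y : 'rV[R]_d => y 0 j) \o shift x)
    (h *: delta_mx 0 i) - x 0 j)) @ 0^' --> ((i == j)%:R : R).
  apply: cvg_near_cst; near=> h.
  have h0 : h != 0 by near: h; exact: nbhs_dnbhs_neq.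
  rewrite /= !mxE eqxx/= addrK [_ *: _]mulKf// eq_sym //.
by split; [apply/cvg_ex; exists (i == j)%:R|apply: cvg_lim].
Unshelve. all: by end_near. Qed.

(** * Double sums with a symmetric summand *)

Lemma sum_lt_sym {R : realType} {d : nat} (F : 'I_d -> 'I_d -> R) :
  (forall i j, F i j = F j i) ->
  2 * (\sum_(i < d) \sum_(j < d | (i < j)%N) F i j) =
  \sum_(i < d) \sum_(j < d) F i j - \sum_(i < d) F i i.
Proof.
move=> Fsym.
have E : \sum_(i < d) \sum_(j < d | (j < i)%N) F i j =
         \sum_(i < d) \sum_(j < d | (i < j)%N) F i j.
  rewrite (exchange_big_dep xpredT)//=; apply: eq_bigr => i _.
  by apply: eq_bigr => j _; exact: Fsym.
rewrite mulr_natl mulr2n -{2}E -!big_split /= -sumrB; apply: eq_bigr => i _.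
rewrite [in RHS](bigID (fun j : 'I_d => (i < j)%N))/= -addrA; congr (_ + _).
apply/eqP; rewrite -subr_eq opprK eq_sym; apply/eqP.
rewrite (bigD1 i) ?ltnn//= addrC; congr (_ + _); apply: eq_bigl => j.
by rewrite -leqNgt ltn_neqAle andbC.
Qed.

(** The algebra behind the spherical operator, with [H] for the Hessian and
    [a] for the gradient: the summand is symmetric in [i] and [j], so twice the
    sum over [i < j] is the full sum minus its diagonal, where the quadratic
    terms cancel and [- 2 y_i a_i] remains; this is why the coefficient of the
    Euler operator is [d - 1] and not [d]. *)
Lemma sum_angular_squares {R : realType} {d : nat} (y a : 'I_d -> R)
    (H : 'I_d -> 'I_d -> R) :
  (forall i j, H i j = H j i) ->
  \sum_(i < d) \sum_(j < d | (i < j)%N)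
    (y i ^+ 2 * H j j + y j ^+ 2 * H i i - 2 * (y i * y j * H i j)
     - y i * a i - y j * a j) =
  (\sum_(i < d) y i ^+ 2) * (\sum_(i < d) H i i)
  - \sum_(i < d) \sum_(j < d) y i * y j * H i j
  - (d%:R - 1) * (\sum_(i < d) y i * a i).
Proof.
move=> Hsym.
have two0 : 2 != 0 :> R by rewrite pnatr_eq0.
apply: (mulfI two0); rewrite sum_lt_sym => [|i j]; last first.
  by rewrite (Hsym j i); ring.
have sq : \sum_(i < d) \sum_(j < d) y i ^+ 2 * H j j =
    (\sum_(i < d) y i ^+ 2) * (\sum_(i < d) H i i) by rewrite big_distrlr.
have lin : \sum_(i < d) \sum_(j < d) y i * a i =
    d%:R * \sum_(i < d) y i * a i.
  rewrite mulr_sumr; apply: eq_bigr => i _.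
  by rewrite sumr_const card_ord mulr_natl.
have -> : \sum_(i < d) \sum_(j < d)
    (y i ^+ 2 * H j j + y j ^+ 2 * H i i - 2 * (y i * y j * H i j)
     - y i * a i - y j * a j) =
    \sum_(i < d) \sum_(j < d) y i ^+ 2 * H j j
    + \sum_(i < d) \sum_(j < d) y j ^+ 2 * H i i
    - 2 * (\sum_(i < d) \sum_(j < d) y i * y j * H i j)
    - \sum_(i < d) \sum_(j < d) y i * a i
    - \sum_(i < d) \sum_(j < d) y j * a j.
  rewrite mulr_sumr -big_split -!sumrB; apply: eq_bigr => i _.
  by rewrite mulr_sumr -big_split -!sumrB.
have -> : \sum_(i < d)
    (y i ^+ 2 * H i i + y i ^+ 2 * H i i - 2 * (y i * y i * H i i)
     - y i * a i - y i * a i) = - 2 * \sum_(i < d) y i * a i.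
  by rewrite mulr_sumr; apply: eq_bigr => i _; ring.
have swap (F : 'I_d -> 'I_d -> R) :
    \sum_(i < d) \sum_(j < d) F j i = \sum_(i < d) \sum_(j < d) F i j.
  exact: exchange_big.
rewrite (swap (fun i j => y i ^+ 2 * H j j)) (swap (fun i j => y i * a i)).
by rewrite sq lin; ring.
Qed.

Lemma sum_spectral_part {R : realType} {d : nat} (y : 'I_d -> R)
    (H : 'I_d -> 'I_d -> R) :
  (forall i j, H i j = H j i) ->
  \sum_(i < d) (1 - y i ^+ 2) * H i i
  - 2 * (\sum_(i < d) \sum_(j < d | (i < j)%N) y i * y j * H i j) =
  \sum_(i < d) H i i - \sum_(i < d) \sum_(j < d) y i * y j * H i j.
Proof.
move=> Hsym; rewrite sum_lt_sym => [|i j]; last by rewrite Hsym; ring.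
have -> : \sum_(i < d) (1 - y i ^+ 2) * H i i =
    \sum_(i < d) H i i - \sum_(i < d) y i * y i * H i i.
  by rewrite -sumrB; apply: eq_bigr => i _; ring.
by ring.
Qed.

(** * The Euclidean norm and radial functions *)

Lemma enorm_sqr {R : realType} {d : nat} (x : 'rV[R]_d) :
  enorm x ^+ 2 = \sum_(i < d) x 0 i ^+ 2.
Proof. by rewrite sqr_sqrtr// sumr_ge0// => i _; exact: sqr_ge0. Qed.

Lemma is_derive_enorm {R : realType} {d : nat} (x : 'rV[R]_d) (i : 'I_d) :
  0 < enorm x ->
  is_derive x (delta_mx 0 i) (@enorm R d) (x 0 i / enorm x).
Proof.
move=> x0.
have Dsq := is_derive_sum_fun
  (fun j => is_derive_comp (is_derive_exprn 2 _) (is_derive_coord x i j)).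
have S0 : 0 < \sum_(j < d) x 0 j ^+ 2 by rewrite -enorm_sqr exprn_gt0.
apply: (is_derive_eq (is_derive_comp (is_derive1_sqrt S0) Dsq)).
have -> : \sum_(j < d) 2%:R * x 0 j ^+ 2.-1 * (i == j)%:R = 2 * x 0 i.
  rewrite (bigD1 i)//= eqxx mulr1 big1 ?addr0// => j /negPf ji.
  by rewrite eq_sym ji mulr0.
rewrite -[Num.sqrt _]/(enorm x); field.
by rewrite gt_eqF.
Qed.

Lemma enorm_continuous {R : realType} {d : nat} :
  continuous (@enorm R d).
Proof.
move=> x; apply: continuous_comp; last exact: sqrt_continuous.
apply: differentiable_continuous.
have -> : (fun y : 'rV[R]_d => \sum_(i < d) y 0 i ^+ 2) =
    \sum_(i < d) (fun y : 'rV[R]_d => y 0 i) ^+ 2.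
  by apply/funext => y; rewrite fct_sumE.
by apply: differentiable_sum => i; apply/differentiableX/differentiable_coord.
Qed.

Lemma near_unit_ball {R : realType} {d : nat} (x : 'rV[R]_d) :
  enorm x < 1 -> \forall y \near x, unit_ball y.
Proof. by move=> x1; apply: (cvgr_lt _ (enorm_continuous x)). Qed.

Lemma is_derive_radial {R : realType} {d : nat} {x : 'rV[R]_d} {phi : R -> R}
    {l : R} (i : 'I_d) :
  0 < enorm x -> is_derive (enorm x) 1 phi l ->
  is_derive x (delta_mx 0 i) (fun y => phi (enorm y))
    (l * (x 0 i / enorm x)).
Proof. by move=> x0 D; exact: (is_derive_comp D (is_derive_enorm x i x0)). Qed.

(** The logarithmic derivative of [s^n (1 - s^2)^(mu+1)] at [r] is
    [n / r - 2 (mu + 1) r / (1 - r^2)]; multiplying by the function itself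
    cancels the denominator [1 - r^2]. *)
Lemma is_derive_radial_weight {R : realType} (n : nat) (mu r : R) :
  0 < r -> r < 1 ->
  is_derive r 1 (fun s : R => s ^+ n * (1 - s ^+ 2) * (1 - s ^+ 2) `^ mu)
    ((n%:R * (1 - r ^+ 2) - 2 * (mu + 1) * r ^+ 2)
       * (r ^+ n * (1 - r ^+ 2) `^ mu) / r).
Proof.
move=> r0 r1.
have w0 : 0 < 1 - r ^+ 2 by rewrite subr_gt0 expr_lt1// ltW.
have Dw : is_derive r 1 (fun s : R => 1 - s ^+ 2) (0 - 2 * r ^+ 1).
  exact: (is_deriveB (is_derive_cst _ _ _) (is_derive_exprn 2 r)).
have D : is_derive r 1
    (fun s : R => s ^+ n * (1 - s ^+ 2) * (1 - s ^+ 2) `^ mu) _ :=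
  is_derive_mul (is_derive_mul (is_derive_exprn n r) Dw)
    (is_derive_comp (g := fun s : R => 1 - s ^+ 2) (phi := fun t : R => t `^ mu)
       (is_derive1_powR mu w0) Dw).
apply: (is_derive_eq D).
have -> : n%:R * r ^+ n.-1 = n%:R * r ^+ n / r :> R.
  case: (n) => [|k]; first by rewrite !mul0r.
  by rewrite exprSr mulrA mulfK// gt_eqF.
clear D Dw.
have -> : (1 - r ^+ 2) `^ (mu - 1) = (1 - r ^+ 2) `^ mu / (1 - r ^+ 2).
  by rewrite powRB ?powRr1// ?ltW// (gt_eqF w0) implybT.
field.
by rewrite !gt_eqF.
Qed.

(** Leibniz rule for the Euler operator, where
    [\sum_i x_i * (x_i / r) = r] turns the gradient of a radial function into
    [r d/dr]. *)
Lemma euler_radial_mul {R : realType} {d : nat} {g : 'rV[R]_d -> R}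
    {phi : R -> R} {x : 'rV[R]_d} {l : R} :
  0 < enorm x -> is_derive (enorm x) 1 phi l ->
  (forall i, derivable g x (delta_mx 0 i)) ->
  euler (fun y => phi (enorm y) * g y) x =
    l * enorm x * g x + phi (enorm x) * euler g x.
Proof.
move=> x0 Dphi dg.
have D i := is_derive_mul (is_derive_radial i x0 Dphi) (derivableP (dg i)).
have P i : partial i (fun y => phi (enorm y) * g y) x = _ :=
  @derive_val _ _ _ _ _ _ _ (D i).
rewrite {1}/euler; under eq_bigr do rewrite P mulrDr.
rewrite big_split/=; congr (_ + _); last first.
  by rewrite mulr_sumr; apply: eq_bigr => i _; rewrite mulrCA.
have -> : l * enorm x * g x = l / enorm x * g x * enorm x ^+ 2.
  by field; rewrite gt_eqF.
rewrite enorm_sqr mulr_sumr; apply: eq_bigr => i _; field.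
by rewrite gt_eqF.
Qed.

(** * Second-order expansions of the operators *)

Lemma Ck2_derivable {R : realType} {d : nat} {f : 'rV[R]_d -> R}
    {x : 'rV[R]_d} (i : 'I_d) :
  Ck_on 2 (@unit_ball R d) f -> enorm x < 1 ->
  derivable f x (delta_mx 0 i).
Proof. by move=> [_ /(_ i)[+ _]] x1; apply. Qed.

Lemma Ck2_derivable2 {R : realType} {d : nat} {f : 'rV[R]_d -> R}
    {x : 'rV[R]_d} (i j : 'I_d) :
  Ck_on 2 (@unit_ball R d) f -> enorm x < 1 ->
  derivable (partial i f) x (delta_mx 0 j).
Proof. by move=> [_ /(_ i)[_ [_ /(_ j)[+ _]]]] x1; apply. Qed.

Lemma partial_symmetric {R : realType} {d : nat} {f : 'rV[R]_d -> R}
    {x : 'rV[R]_d} (i j : 'I_d) :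
  Ck_on 2 (@unit_ball R d) f -> enorm x < 1 ->
  partial i (partial j f) x = partial j (partial i f) x.
Proof.
move=> hf x1; have nU := near_unit_ball x x1.
have cont k l : {for x, continuous (partial k (partial l f))}.
  by move: hf => [_ /(_ l)[_ [_ /(_ k)[_ [+ _]]]]]; apply.
apply: derive_symmetric.
- by apply: filterS nU => y y1; split; apply: Ck2_derivable.
- by apply: filterS nU => y y1; split; apply: Ck2_derivable2.
- exact: cont.
- exact: cont.
Qed.

Lemma is_derive_euler {R : realType} {d : nat} {f : 'rV[R]_d -> R}
    {x : 'rV[R]_d} (i : 'I_d) :
  Ck_on 2 (@unit_ball R d) f -> enorm x < 1 ->
  is_derive x (delta_mx 0 i) (euler f)
    (partial i f x + \sum_(j < d) x 0 j * partial i (partial j f) x).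
Proof.
move=> hf x1.
have D := is_derive_sum_fun (fun j => is_derive_mul (is_derive_coord x i j)
  (derivableP (Ck2_derivable2 j i hf x1))).
apply: (is_derive_eq D).
rewrite big_split/=; congr (_ + _).
rewrite (bigD1 i)//= eqxx mul1r big1 ?addr0// => j /negPf ji.
by rewrite eq_sym ji mul0r.
Qed.

(** The extra [euler f x] comes from differentiating the coefficients [x_i] of
    the Euler operator. *)
Lemma euler_euler {R : realType} {d : nat} {f : 'rV[R]_d -> R} {x : 'rV[R]_d} :
  Ck_on 2 (@unit_ball R d) f -> enorm x < 1 ->
  euler (euler f) x = euler f x +
    \sum_(i < d) \sum_(j < d) x 0 i * x 0 j * partial i (partial j f) x.
Proof.
move=> hf x1; rewrite {1}/euler -big_split/=; apply: eq_bigr => i _.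
have -> : partial i (euler f) x = _ :=
  @derive_val _ _ _ _ _ _ _ (is_derive_euler i hf x1).
rewrite mulrDr mulr_sumr; congr (_ + _).
by apply: eq_bigr => j _; rewrite mulrA.
Qed.

Lemma angular_angular {R : realType} {d : nat} {f : 'rV[R]_d -> R}
    {x : 'rV[R]_d} (i j : 'I_d) :
  Ck_on 2 (@unit_ball R d) f -> enorm x < 1 -> i != j ->
  angular i j (angular i j f) x =
    x 0 i ^+ 2 * partial j (partial j f) x
    + x 0 j ^+ 2 * partial i (partial i f) x
    - 2 * (x 0 i * x 0 j * partial i (partial j f) x)
    - x 0 i * partial i f x - x 0 j * partial j f x.
Proof.
move=> hf x1 /negPf ij.
have D k : is_derive x (delta_mx 0 k) (angular i j f)
    ((k == i)%:R * partial j f x + x 0 i * partial k (partial j f) x -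
     ((k == j)%:R * partial i f x + x 0 j * partial k (partial i f) x)).
  exact: (is_deriveB
    (is_derive_mul (is_derive_coord x k i)
       (derivableP (Ck2_derivable2 j k hf x1)))
    (is_derive_mul (is_derive_coord x k j)
       (derivableP (Ck2_derivable2 i k hf x1)))).
have P k : partial k (angular i j f) x = _ := @derive_val _ _ _ _ _ _ _ (D k).
rewrite -[LHS]/(x 0 i * partial j (angular i j f) x
  - x 0 j * partial i (angular i j f) x) !P !eqxx eq_sym ij.
have := partial_symmetric j i hf x1.
generalize (partial i (partial j f) x) (partial i (partial i f) x)
  (partial j (partial j f) x) (partial j (partial i f) x)
  (partial i f x) (partial j f x) => fij fii fjj fji fi fj ->.
rewrite mulr0n mulr1n; ring.
Qed.

Lemma spherical_opE {R : realType} {d : nat} {f : 'rV[R]_d -> R}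
    {x : 'rV[R]_d} :
  Ck_on 2 (@unit_ball R d) f -> enorm x < 1 ->
  spherical_op f x =
    enorm x ^+ 2 * (\sum_(i < d) partial i (partial i f) x)
    - \sum_(i < d) \sum_(j < d) x 0 i * x 0 j * partial i (partial j f) x
    - (d%:R - 1) * euler f x.
Proof.
move=> hf x1; rewrite enorm_sqr.
rewrite -(sum_angular_squares (fun i => x 0 i) (fun i => partial i f x)
  (fun i j => partial i (partial j f) x)); last first.
  by move=> i j; exact: partial_symmetric.
apply: eq_bigr => i _; apply: eq_bigr => j ij; apply: angular_angular => //.
by rewrite -val_eqE/= ltn_eqF.
Qed.

Lemma spectral_opE {R : realType} {d : nat} {mu : R} {f : 'rV[R]_d -> R}
    {x : 'rV[R]_d} :
  Ck_on 2 (@unit_ball R d) f -> enorm x < 1 ->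
  spectral_op mu f x =
    \sum_(i < d) partial i (partial i f) x
    - \sum_(i < d) \sum_(j < d) x 0 i * x 0 j * partial i (partial j f) x
    - (d%:R + 2 * mu + 1) * euler f x.
Proof.
move=> hf x1; congr (_ - _).
apply: (sum_spectral_part (fun i => x 0 i)
  (fun i j => partial i (partial j f) x)) => i j.
exact: partial_symmetric.
Qed.

(** * Polar form of the spectral operator *)

Theorem theorem4p2 (R : realType) (d : nat) (mu : R)
    (hd : (2 <= d)%N) (hmu : -1 < mu)
    (f : 'rV[R]_d -> R) (hf : Ck_on 2 (@unit_ball R d) f)
    (x : 'rV[R]_d) (hx0 : 0 < enorm x) (hx1 : enorm x < 1) :
  spectral_op mu f x =
    1 / (weight mu x * enorm x ^+ d) *
      euler (fun y : 'rV[R]_d =>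
        enorm y ^+ (d - 2) * (1 - enorm y ^+ 2) * weight mu y * euler f y) x
    + 1 / enorm x ^+ 2 * spherical_op f x.
Proof.
have dg i : derivable (euler f) x (delta_mx 0 i).
  by case: (is_derive_euler i hf hx1).
have w0 : weight mu x != 0.
  by rewrite gt_eqF// powR_gt0// subr_gt0 expr_lt1// ltW.
have r0 : enorm x != 0 by rewrite gt_eqF.
rewrite (spectral_opE hf hx1) (spherical_opE hf hx1).
rewrite (euler_radial_mul hx0 (is_derive_radial_weight (d - 2) mu _ hx0 hx1) dg).
rewrite (euler_euler hf hx1) -/(weight mu x).
have -> : enorm x ^+ d = enorm x ^+ (d - 2) * enorm x ^+ 2.
  by rewrite -exprD subnK.
rewrite (natrB R hd).
move: w0 r0.
generalize (\sum_(i < d) \sum_(j < d)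
    x 0 i * x 0 j * partial i (partial j f) x)
  (\sum_(i < d) partial i (partial i f) x) (euler f x) (weight mu x) (enorm x)
  => Q L E w r w0 r0.
(* The power [r ^+ (d - 2)] cancels, so it is treated as an unknown. *)
have rn0 : r ^+ (d - 2) != 0 by rewrite expf_neq0.
move: rn0; generalize (r ^+ (d - 2)) => rn rn0.
field.
by rewrite w0 r0 rn0.
Qed.
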